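(* Let $Z$ be a $\mathcal{Z}$-valued random variable with probability density $f_\star$ with respect to $dz$, and write $\mathbb{P}_\star,\mathbb{E}_\star$ for probability and expectation under $f_\star$. Let $\theta_\star\in\mathbb{R}^p$, $\theta_\star\neq 0$, let $\delta_\star\in\Delta$ be the support of $\theta_\star$ and $s_\star=\|\theta_\star\|_0$. Let $\bar\rho,\bar\kappa$ be finite positive constants such that $\mathbb{P}_\star(Z\in\mathcal{E}_0)>0$, where $\mathcal{E}_0$ is the set defined in the context, and suppose $32\rho_1\|\theta_\star\|_\infty\le\bar\rho$. Suppose the prior on $\delta$ is $\omega(\delta)=\mathsf{q}^{\|\delta\|_0}(1-\mathsf{q})^{p-\|\delta\|_0}$, $\delta\in\Delta$, where $\mathsf{q}\in(0,1)$ satisfies $\frac{\mathsf{q}}{1-\mathsf{q}}=\frac{1}{p^{u+1}}$ for some absolute constant $u>0$, and that $p\ge 9$ and $p^{u/2}\ge 2e^{2\rho_1}$. Suppose that there exist a rate function $\mathsf{r}_0$ and a measurable subset $\mathcal{E}\subseteq\mathcal{E}_0$ such that for all $\delta\in\Delta$ and all $v\in\mathbb{R}^p_\delta$, $$\log\mathbb{E}_\star\left[\mathbf{1}_{\mathcal{E}}(Z)\,e^{\mathcal{L}_{\theta_\star}(v;Z)+\left(1-\frac{\rho_1}{\bar\rho}\right)\langle\nabla\ell(\theta_\star;Z),\,v-\theta_\star\rangle}\right]\le\begin{cases}-\frac12\mathsf{r}_0\left(\|\delta_\star\cdot(v-\theta_\star)\|_2\right)&\text{if }\|\delta_\star^c\cdot(v-\theta_\star)\|_1\le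 7\|\delta_\star\cdot(v-\theta_\star)\|_1,\\ 0&\text{otherwise.}\end{cases}$$ Let $\mathsf{a}_0=-\min_{x>0}\left[\mathsf{r}_0(x)-4\rho_1 s_\star^{1/2}x\right]$. If for some absolute constant $c_0$ we have $$s_\star\left(\frac12+2\rho_1\right)+\frac{s_\star}{2}\log\left(1+\frac{\bar\kappa}{\rho_1}\right)+\frac{\mathsf{a}_0}{2}+2\rho_1\|\theta_\star\|_2^2\le c_0 s_\star\log(p),$$ then for all $j\ge1$, $$\mathbb{E}_\star\left[\mathbf{1}_{\mathcal{E}}(Z)\,\Pi\left(\|\delta\|_0\ge s_\star\left(1+\frac{2(1+c_0)}{u}\right)+j\;\Big|\;Z\right)\right]\le\frac{2}{p^{uj/2}}.$$
   Context: Setting: $\mathcal{Z}$ is a measurable space with a sigma-finite reference measure $dz$; $\ell:\mathbb{R}^p\times\mathcal{Z}\to\mathbb{R}$ is jointly measurable and thrice differentiable in its first argument for every $z$; $\nabla$ denotes differentiation with respect to the first argument. $\rho_0,\rho_1>0$ are prior parameters. An absolute constant is one that does not depend on $p$; all other quantities may depend on $p$. Notation: $\Delta=\{0,1\}^p$; $\theta\cdot\theta'$ is the componentwise product; $\theta_\delta=\theta\cdot\delta$; $\mathbb{R}^p_\delta=\{\theta\cdot\delta:\theta\in\mathbb{R}^p\}$; $\delta^c$ is the componentwise complement $1-\delta$; $\|\cdot\|_0$ is the number of nonzero components. Quasi-posterior distribution on $\Delta\times\mathbb{R}^p$: $$\Pi(\delta,d\theta\mid z)\propto e^{\ell(\theta_\delta;z)}\,\omega(\delta)\left(\tfrac{\rho_1}{2\pi}\right)^{\|\delta\|_0/2}\left(\tfrac{\rho_0}{2\pi}\right)^{(p-\|\delta\|_0)/2}e^{-\frac{\rho_1}{2}\|\theta_\delta\|_2^2}e^{-\frac{\rho_0}{2}\|\theta-\theta_\delta\|_2^2}\,d\theta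 .$$ $\Pi(\cdot\mid z)$ is well-defined when this can be normalized. $\mathcal{L}_{\theta_1}(\theta;z)=\ell(\theta;z)-\ell(\theta_1;z)-\langle\nabla\ell(\theta_1;z),\theta-\theta_1\rangle$. $\mathcal{E}_0=\{z\in\mathcal{Z}:\ \Pi(\cdot\mid z)\text{ is well-defined},\ \|\nabla\ell(\theta_\star;z)\|_\infty\le\bar\rho/2,\ \text{and }\mathcal{L}_{\theta_\star}(\theta;z)\ge-\frac{\bar\kappa}{2}\|\theta-\theta_\star\|_2^2\text{ for all }\theta\in\mathbb{R}^p_{\delta_\star}\}$. A rate function is a continuous increasing function $\mathsf{r}:[0,\infty)\to[0,\infty)$ with $\mathsf{r}(0)=0$ and $\lim_{x\downarrow0}\mathsf{r}(x)/x=0$. *)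

(* Defs.v *)
From HB Require Import structures.
From mathcomp Require Import all_boot all_order all_algebra.
From mathcomp Require Import all_classical all_reals all_analysis.

Set Implicit Arguments.
Unset Strict Implicit.
Unset Printing Implicit Defensive.
Import Order.TTheory GRing.Theory Num.Theory.
Import numFieldNormedType.Exports.

Local Open Scope classical_set_scope.
Local Open Scope ring_scope.

(* R^p appears in two guises: the normed space 'rV[R]_p, for differential
   calculus, and the measurable space p.-tuple (measurableTypeR R), with its
   product sigma-algebra, for integration; vec_of_tuple identifies them. *)
Definition vec_of_tuple (R : realType) (p : nat)
    (t : p.-tuple (measurableTypeR R)) : 'rV[R]_p :=
  \row_i (tnth t i : R).

Section lebesgue_measure_tuple.
Local Open Scope ereal_scope.
Variable R : realType.
Notation M := (measurableTypeR R).

Definition cons_pair (n : nat) (x : M * n.-tuple M) : n.+1.-tuple M :=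
  [tuple of x.1 :: x.2].

Lemma measurable_cons_pair (n : nat) :
  measurable_fun [set: M * n.-tuple M] (@cons_pair n).
Proof. exact: measurable_cons. Qed.

Section step.
Variables (n : nat) (mu : {sigma_finite_measure set (n.-tuple M) -> \bar R}).

Definition lebesgue_tuple_step : set (n.+1.-tuple M) -> \bar R :=
  pushforward (@lebesgue_measure R \x mu) (@cons_pair n).

Let step0 : lebesgue_tuple_step set0 = 0.
Proof. by rewrite /lebesgue_tuple_step /pushforward preimage_set0 measure0. Qed.

Let step_ge0 A : 0 <= lebesgue_tuple_step A.
Proof. by rewrite /lebesgue_tuple_step /pushforward; exact: measure_ge0. Qed.

Let step_sigma_additive : semi_sigma_additive lebesgue_tuple_step.
Proof.
move=> F mF tF mUF; rewrite /lebesgue_tuple_step /pushforward preimage_bigcup.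
apply: measure_semi_sigma_additive.
- by move=> k; rewrite -[X in measurable X]setTI; exact: measurable_cons_pair.
- apply/trivIsetP => /= i j _ _ ij; rewrite -preimage_setI.
  by move/trivIsetP : tF => /(_ _ _ _ _ ij) ->//; rewrite preimage_set0.
- by rewrite -preimage_bigcup -[X in measurable X]setTI;
    exact: measurable_cons_pair.
Qed.

HB.instance Definition _ := isMeasure.Build _ _ _ lebesgue_tuple_step
  step0 step_ge0 step_sigma_additive.

Let step_sigma_finite : sigma_finite setT lebesgue_tuple_step.
Proof.
have /sigma_finiteP[F [TF ndF Foo]] := sigma_finiteT (@lebesgue_measure R).
have /sigma_finiteP[G [TG ndG Goo]] := sigma_finiteT mu.
pose uncons (t : n.+1.-tuple M) := (thead t : M, [tuple of behead t]).
have muncons : measurable_fun setT uncons.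
  by apply/measurable_fun_pairP; split;
    [exact: measurable_tnth|exact: measurable_behead].
exists (fun k => uncons @^-1` (F k `*` G k)).
  rewrite -preimage_bigcup; apply/esym/seteqP; split => // t _ /=.
  have [i _ Fi] : (\bigcup_i F i) (thead t) by rewrite -TF.
  have [j _ Gj] : (\bigcup_i G i) [tuple of behead t] by rewrite -TG.
  exists (maxn i j) => //; split => /=.
  - by move: Fi; exact/subsetPset/ndF/leq_maxl.
  - by move: Gj; exact/subsetPset/ndG/leq_maxr.
move=> k; have [mF Fk] := Foo k; have [mG Gk] := Goo k; split.
  by rewrite -[X in measurable X]setTI; apply: muncons => //;
    exact: measurableX.
rewrite /lebesgue_tuple_step /pushforward -comp_preimage.
have -> : uncons \o @cons_pair n = id.
  by apply/funext => -[x t] /=; congr pair; exact/val_inj.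
rewrite preimage_id product_measure1E//.
by rewrite lte_mul_pinfty// ge0_fin_numE.
Qed.

HB.instance Definition _ := Measure_isSigmaFinite.Build _ _ _
  lebesgue_tuple_step step_sigma_finite.

End step.

(* Lebesgue measure on R^n, as the n-fold product of the one on R. *)
Fixpoint lebesgue_tuple (n : nat) :
    {sigma_finite_measure set (n.-tuple M) -> \bar R} :=
  match n with
  | 0 => [the {sigma_finite_measure set (0.-tuple M) -> \bar R} of
            dirac [tuple]]
  | n'.+1 => [the {sigma_finite_measure set (n'.+1.-tuple M) -> \bar R} of
            lebesgue_tuple_step (lebesgue_tuple n')]
  end.

End lebesgue_measure_tuple.

Section vectors.
Variables (R : realType) (p : nat).
Implicit Types (u v : 'rV[R]_p) (delta : {ffun 'I_p -> bool}).

Definition cwise_mul u v : 'rV[R]_p := \row_i (u 0 i * v 0 i).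

Definition inner u v : R := \sum_i u 0 i * v 0 i.

Definition norm_l0 v : nat := #|[set i | v 0 i != 0]%SET|.
Definition norm_l1 v : R := \sum_i `|v 0 i|.
Definition norm_l2 v : R := Num.sqrt (\sum_i v 0 i ^+ 2).
(* The library's norm on matrices is the largest absolute value of an entry. *)
Definition norm_linf v : R := `|v|.

(* Delta = {0,1}^p is represented by the finite type {ffun 'I_p -> bool}. *)
Definition delta_vec delta : 'rV[R]_p := \row_i (delta i)%:R.
Definition delta_compl delta : {ffun 'I_p -> bool} := [ffun i => ~~ delta i].
Definition delta_supp v : {ffun 'I_p -> bool} := [ffun i => v 0 i != 0].

Definition proj_delta v delta : 'rV[R]_p := cwise_mul v (delta_vec delta).
Definition Rdelta delta : set 'rV[R]_p := range (proj_delta^~ delta).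

End vectors.

Section gradient.
Variables (R : realType) (p : nat).
Implicit Type f : 'rV[R]_p -> R.

Definition gradient f (x : 'rV[R]_p) : 'rV[R]_p := \row_i 'D_(delta_mx 0 i) f x.

Definition hessian f (x : 'rV[R]_p) : 'M[R]_p := jacobian (gradient f) x.

(* Frechet differentiability of f, of its first and of its second derivative,
   the latter two being represented by the gradient and the Hessian matrix. *)
Definition thrice_differentiable f :=
  [/\ forall x, differentiable f x,
      forall x, differentiable (gradient f) x &
      forall x, differentiable (hessian f) x].

End gradient.

(* r is a function on all of R, of which only the restriction to [0, +oo[
   matters; "increasing" is meant in the wide sense. *)
Definition rate_function (R : realType) (r : R -> R) :=
  [/\ forall x, 0 <= x -> 0 <= r x,
      {within `[0, +oo[, continuous r},
      {in `[0, +oo[ &, {homo r : x y / x <= y}},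
      r 0 = 0 &
      r x / x @[x --> 0^'+] --> 0].

Section quasi_posterior.
Variables (R : realType) (p : nat) (Zt : Type).
Variables (ell : 'rV[R]_p -> Zt -> R) (rho0 rho1 : R).
Variable omega : {ffun 'I_p -> bool} -> R.
Implicit Types (z : Zt) (delta : {ffun 'I_p -> bool}) (theta : 'rV[R]_p).

Definition qp_density z delta theta : R :=
  expR (ell (proj_delta theta delta) z) * omega delta
  * (rho1 / (2 * pi)) `^ ((norm_l0 (delta_vec R delta))%:R / 2)
  * (rho0 / (2 * pi)) `^ ((p%:R - (norm_l0 (delta_vec R delta))%:R) / 2)
  * expR (- (rho1 / 2) * norm_l2 (proj_delta theta delta) ^+ 2)
  * expR (- (rho0 / 2) * norm_l2 (theta - proj_delta theta delta) ^+ 2).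

Definition qp_mass z (A : set ({ffun 'I_p -> bool} * 'rV[R]_p)) : \bar R :=
  (\sum_(delta : {ffun 'I_p -> bool})
    \int[lebesgue_tuple R p]_(t in [set t | A (delta, vec_of_tuple t)])
      (qp_density z delta (vec_of_tuple t))%:E)%E.

Definition qp_well_defined z := (0 < qp_mass z setT < +oo)%E.

(* Only meaningful when qp_well_defined z holds: the extended-real quotient is
   total (x / +oo = 0). *)
Definition quasi_posterior z (A : set ({ffun 'I_p -> bool} * 'rV[R]_p)) :
    \bar R :=
  (qp_mass z A / qp_mass z setT)%E.

Definition lin_remainder (theta1 theta : 'rV[R]_p) z : R :=
  ell theta z - ell theta1 z - inner (gradient (ell^~ z) theta1) (theta - theta1).

Definition event0 (theta_star : 'rV[R]_p) (rhobar kappabar : R) : set Zt :=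
  [set z | [/\ qp_well_defined z,
    norm_linf (gradient (ell^~ z) theta_star) <= rhobar / 2 &
    forall theta, Rdelta (delta_supp theta_star) theta ->
      - (kappabar / 2) * norm_l2 (theta - theta_star) ^+ 2
        <= lin_remainder theta_star theta z]].

End quasi_posterior.

(* Main.v *)
Require Import Defs.
From HB Require Import structures.
From mathcomp Require Import all_boot all_order all_algebra.
From mathcomp Require Import all_classical all_reals all_analysis.
From mathcomp Require Import measurable_realfun ring lra.

Set Implicit Arguments.
Unset Strict Implicit.
Unset Printing Implicit Defensive.
Import Order.TTheory GRing.Theory Num.Theory.
Import numFieldNormedType.Exports.

Local Open Scope classical_set_scope.
Local Open Scope ring_scope.

(** Write D for the normalizing constant of the quasi-posterior, k for the
    number of ones of a model delta, s for the sparsity of theta_star.  On the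
    event E the log-likelihood is bounded below by a quadratic on the true
    model, so keeping only the term of the true model in D and completing the
    square in each coordinate gives an explicit lower bound
    D >= exp (ell theta_star) * omega delta_star * Lambda, with Lambda a
    constant ([qp_mass_ge]).

    Hence the expected posterior mass of a model delta is at most
    omega delta / (omega delta_star * Lambda) times the expectation of the
    prior average of the likelihood ratio exp (ell v - ell theta_star).  By
    Tonelli the expectation may be taken first, for fixed v.  With
    h = v - theta_star, the log-ratio is the exponent of the moment hypothesis
    plus (rho1 / rhobar) <G, h>, where G is the gradient at theta_star, and the
    latter is at most (rho1 / 2) |h|_1 on E ([log_ratio_le]).  In the cone the
    rate function absorbs the part of |h|_1 carried by the support, at the
    price of a0 / 2; out of the cone that part is at most a seventh of the
    rest.  In both cases only exp (a0 / 2 + (4 / 7) rho1 |h_off|_1) is left,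
    where h_off is the part of h off the support ([cone_exponent_le]).
    Averaging this over the Gaussian prior costs at most B = exp (1/2 + 2 rho1)
    per active coordinate ([laplace_gauss_le], [prior_laplace_le]).

    So the expected mass of delta is at most
    omega delta / (omega delta_star * Lambda) * exp (a0 / 2) * B ^ k.  Split
    B ^ k as B ^ s * B ^ (k - s): the first factor is the term
    s (1/2 + 2 rho1) of the assumption on c0, and B <= 2 exp (2 rho1)
    <= p ^ (u / 2) bounds the second one.  As the prior ratio is
    p ^ (- (u + 1) (k - s)), for k at least s (1 + 2 (1 + c0) / u) + j
    everything collapses to p ^ (- u j / 2) * p ^ (- k)
    ([posterior_exponent_le]).  Finally the sum of p ^ (- k) over the nonempty
    models is (1 + 1 / p) ^ p - 1 <= e - 1 <= 2 ([sum_delta_powers_le]). *)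

(** * Integration over tuples *)

(** The integral of a nonnegative function is the supremum over the simple
    functions below it, so it is monotone on arbitrary functions.  This is how
    integrands that involve the gradient of the likelihood, as functions of the
    data, are compared with measurable ones. *)
Lemma le_integral_nonneg d (T : measurableType d) (R : realType)
    (mu : {measure set T -> \bar R}) (f g : T -> \bar R) :
  (forall x, 0 <= f x)%E -> (forall x, f x <= g x)%E ->
  (\int[mu]_x f x <= \int[mu]_x g x)%E.
Proof.
move=> f0 fg; rewrite !ge0_integralTE//; last first.
  by move=> x; exact: le_trans (f0 x) (fg x).
apply: le_ereal_sup => _ [h /= hf <-]; exists h => //= x.
exact: le_trans (hf x) (fg x).
Qed.

Section product_integral.
Variable R : realType.
Notation M := (measurableTypeR R).

Lemma measurable_prod_tnth n (f : 'I_n -> R -> R) :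
  (forall i, measurable_fun setT (f i)) ->
  measurable_fun setT (fun t : n.-tuple M => \prod_i f i (tnth t i)).
Proof.
move=> mf; apply: measurable_prod => i _.
exact: (measurableT_comp (mf i) (measurable_tnth i)).
Qed.

(** Tonelli, one coordinate at a time.  The one-dimensional integrals are
    assumed finite so that their product is one of real numbers. *)
Lemma integral_prod_tnth n (f : 'I_n -> R -> R) (c : 'I_n -> R) :
  (forall i, measurable_fun setT (f i)) -> (forall i x, 0 <= f i x) ->
  (forall i, \int[@lebesgue_measure R]_x (f i x)%:E = (c i)%:E)%E ->
  (\int[lebesgue_tuple R n]_t (\prod_i f i (tnth t i))%:E
    = (\prod_i c i)%:E)%E.
Proof.
elim: n f c => [|n IHn] f c mf f0 fc.
  rewrite big_ord0 /= integral_dirac//=; first by rewrite diracT mul1e big_ord0.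
  by apply/measurable_EFinP; exact: measurable_prod_tnth.
have mprod : measurable_fun setT
    (fun t : n.+1.-tuple M => (\prod_i f i (tnth t i))%:E).
  by apply/measurable_EFinP; exact: measurable_prod_tnth.
rewrite [LHS](@ge0_integral_pushforward _ _ _ _ _ _
  (measurable_cons_pair (R := R) (n := n)))//; last first.
  by move=> t _; rewrite lee_fin prodr_ge0.
rewrite preimage_setT.
rewrite (fubini_tonelli1 (m1 := @lebesgue_measure R)
  (m2 := lebesgue_tuple R n)); last 2 first.
  - exact: measurableT_comp mprod (@measurable_cons_pair R n).
  - by move=> t; rewrite lee_fin prodr_ge0.
rewrite /fubini_F /=.
pose g (t : n.-tuple M) := \prod_i f (lift ord0 i) (tnth t i).
have mg : measurable_fun setT (fun t => (g t)%:E).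
  by apply/measurable_EFinP; exact: (@measurable_prod_tnth n (fun i => f (lift ord0 i))).
have g0 t : 0 <= g t by exact: prodr_ge0.
have IHg : (\int[lebesgue_tuple R n]_t (g t)%:E =
    (\prod_i c (lift ord0 i))%:E)%E.
  exact: (IHn (fun i => f (lift ord0 i))).
transitivity (\int[@lebesgue_measure R]_x
    ((\prod_i c (lift ord0 i))%:E * (f ord0 x)%:E))%E.
  apply: eq_integral => x _.
  transitivity (\int[lebesgue_tuple R n]_t ((f ord0 x)%:E * (g t)%:E))%E.
    apply: eq_integral => t _.
    rewrite big_ord_recl -EFinM; congr (_ * _)%:E.
    by apply: eq_bigr => i _; rewrite tnthS.
  rewrite [RHS]muleC -IHg; apply: ge0_integralZl_EFin => //.
  by move=> t _; rewrite lee_fin; exact: g0.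
transitivity ((\prod_i c (lift ord0 i))%:E *
    \int[@lebesgue_measure R]_x (f ord0 x)%:E)%E.
  apply: ge0_integralZl_EFin => //.
  - by move=> x _; rewrite lee_fin.
  - by apply/measurable_EFinP; exact: (mf ord0).
  - by rewrite -lee_fin -IHg; apply: integral_ge0 => t _; rewrite lee_fin; exact: g0.
by rewrite fc -EFinM big_ord_recl mulrC.
Qed.

End product_integral.

(** * One-dimensional Gaussian estimates *)

Section gauss.
Variable R : realType.
Implicit Types tau x m : R.

(** The centered normal density of precision (inverse variance) [tau]. *)
Definition gauss tau x : R :=
  Num.sqrt (tau / (2 * pi)) * expR (- (tau / 2) * x ^+ 2).

Lemma gauss_ge0 tau x : 0 <= gauss tau x.
Proof. by rewrite mulr_ge0 ?sqrtr_ge0 ?expR_ge0. Qed.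

Lemma measurable_gauss tau m :
  measurable_fun setT (fun x => gauss tau (x - m)).
Proof.
apply: measurable_funM => //; apply: measurableT_comp => //.
apply: measurable_funM => //; apply: measurable_funX.
exact: measurable_funB.
Qed.

Lemma integral_gauss tau m : 0 < tau ->
  (\int[@lebesgue_measure R]_x (gauss tau (x - m))%:E = 1)%E.
Proof.
move=> tau0; pose s := (Num.sqrt tau)^-1.
have s0 : s != 0 by rewrite invr_eq0 sqrtr_eq0 -ltNge.
have s2 : s ^+ 2 = tau^-1 by rewrite exprVn sqr_sqrtr// ltW.
rewrite -(integral_normal_pdf m s); apply: eq_integral => x _.
rewrite normal_pdfE// /gauss /normal_peak /normal_fun s2; congr (_ * expR _)%:E.
  rewrite -sqrtrV; last by rewrite mulrn_wge0// mulr_ge0 ?invr_ge0 ?pi_ge0// ltW.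
  congr Num.sqrt; have := pi_gt0 R; move: pi => y y0.
  by field; rewrite !gt_eqF.
by field; rewrite gt_eqF.
Qed.

Lemma integral_prod_gauss n (a : R) (c tau m : 'I_n -> R) :
  0 <= a -> (forall i, 0 <= c i) -> (forall i, 0 < tau i) ->
  (\int[lebesgue_tuple R n]_t
    (a * \prod_i (c i * gauss (tau i) (tnth t i - m i)))%:E
   = (a * \prod_i c i)%:E)%E.
Proof.
move=> a0 c0 tau0; pose f i x := c i * gauss (tau i) (x - m i).
have mf i : measurable_fun setT (f i).
  by apply: measurable_funM => //; exact: measurable_gauss.
have f0 i x : 0 <= f i x by rewrite mulr_ge0 ?gauss_ge0.
under eq_integral do rewrite EFinM.
rewrite ge0_integralZl_EFin//.
- rewrite (@integral_prod_tnth R n f c)// => i.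
  under eq_integral do rewrite EFinM.
  rewrite ge0_integralZl_EFin//.
  + by rewrite integral_gauss// mule1.
  + by move=> x _; rewrite lee_fin gauss_ge0.
  + by apply/measurable_EFinP; exact: measurable_gauss.
- by move=> t _; rewrite lee_fin prodr_ge0// => i _; exact: f0.
- by apply/measurable_EFinP; exact: (@measurable_prod_tnth R n f).
Qed.

(** From (5/6)^6 <= exp(-1/6)^6 = 1/e and (6/5)^6 < 3. *)
Lemma expR1_le3 : expR 1 <= 3 :> R.
Proof.
have e6 : (5 / 6 : R) ^+ 6 <= expR (-1).
  have -> : -1 = 6%:R * (- 6^-1) :> R by field.
  rewrite expRM_natl; apply: lerXn2r; rewrite ?nnegrE ?expR_ge0 ?divr_ge0//.
  by apply: le_trans (expR_ge1Dx _); lra.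
rewrite -[leLHS]invrK -expRN -[leRHS]invrK lef_pV2 ?posrE ?expR_gt0 ?invr_gt0//.
by apply: le_trans e6; lra.
Qed.

Lemma expR1_ge2 : 2 <= expR 1 :> R.
Proof. by apply: le_trans (expR_ge1Dx _); lra. Qed.

(** Completing the square in a Gaussian tilted by a concave quadratic: the
    difference of the two exponents is
    (G - rho x0)^2 / (2 (rho + kappa)).  The left-hand side is a multiple of a
    shifted Gaussian density, hence has an explicit integral that does not
    depend on [G]. *)
Lemma tilted_gauss_ge rho kappa G x0 x : 0 < rho -> 0 < kappa ->
  Num.sqrt (rho / (rho + kappa)) * expR (- (rho / 2) * x0 ^+ 2)
    * gauss (rho + kappa) (x - (x0 + (G - rho * x0) / (rho + kappa)))
  <= expR (G * (x - x0) - kappa / 2 * (x - x0) ^+ 2) * gauss rho x.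
Proof.
move=> r0 k0; have rk0 : 0 < rho + kappa by exact: addr_gt0.
have sq : Num.sqrt (rho / (2 * pi)) = Num.sqrt (rho / (rho + kappa)) *
    Num.sqrt ((rho + kappa) / (2 * pi)).
  rewrite -sqrtrM; last by rewrite divr_ge0// ltW.
  congr Num.sqrt; have := pi_gt0 R; move: pi => y y0.
  by field; rewrite !gt_eqF.
rewrite /gauss sq.
rewrite -(mulrA (Num.sqrt _)) (mulrCA (expR (- _ * _))) -expRD.
rewrite (mulrCA (expR (_ - _))) -expRD -!mulrA.
do 2 (apply: ler_wpM2l; first exact: sqrtr_ge0).
rewrite ler_expR -subr_ge0.
rewrite (_ : _ - _ = (G - rho * x0) ^+ 2 / (2 * (rho + kappa))); last first.
  by field; rewrite gt_eqF.
by rewrite divr_ge0 ?sqr_ge0// mulr_ge0// ltW.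
Qed.

(** Half of the Gaussian exponent pays for the exponential of the absolute
    value: (4/7) rho |x| <= rho x^2 / 4 + (16/49) rho.  Halving the precision
    costs a factor sqrt 2 <= exp (1/2), and 16/49 <= 2. *)
Lemma laplace_gauss_le rho x : 0 < rho ->
  expR (4 / 7 * rho * `|x|) * gauss rho x
  <= expR (1 / 2 + 2 * rho) * gauss (rho / 2) x.
Proof.
move=> r0.
have sq : Num.sqrt (rho / (2 * pi)) = Num.sqrt 2 *
    Num.sqrt (rho / 2 / (2 * pi)) :> R.
  rewrite -sqrtrM//.
  congr Num.sqrt; have := pi_gt0 R; move: pi => y y0.
  by field; rewrite gt_eqF.
rewrite /gauss sq expRD; set A := Num.sqrt (_ / _).
set e1 := expR _; set e2 := expR _; set e3 := expR _; set e4 := expR _.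
set e5 := expR _; set r2 := Num.sqrt 2.
rewrite (_ : e1 * _ = A * (r2 * (e1 * e2))); last by ring.
rewrite (_ : e3 * _ * _ = A * (e3 * (e4 * e5))); last by ring.
apply: ler_wpM2l; first exact: sqrtr_ge0.
have s2 : Num.sqrt 2 <= expR (1 / 2) :> R.
  rewrite -(ler_pXn2r (n := 2))// ?nnegrE ?sqrtr_ge0 ?expR_ge0//.
  rewrite sqr_sqrtr// -expRM_natl (_ : _ * _ = 1); first exact: expR1_ge2.
  by field.
apply: ler_pM; rewrite ?sqrtr_ge0// ?mulr_ge0 ?expR_ge0//.
rewrite /e1 /e2 /e4 /e5 -!expRD ler_expR -subr_ge0.
have xx : x ^+ 2 = `|x| ^+ 2 by rewrite real_normK// num_real.
rewrite xx; set y := `|x|.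
rewrite (_ : _ - _ = rho * ((y / 2 - 4 / 7) ^+ 2 + (2 - 16 / 49))); last by field.
by rewrite mulr_ge0 ?(ltW r0)// addr_ge0 ?sqr_ge0//; lra.
Qed.

End gauss.

(** * Vectors and models *)

Section vector_lemmas.
Variables (R : realType) (p : nat).
Implicit Types (v : 'rV[R]_p) (delta : {ffun 'I_p -> bool}).

Lemma norm_l2_sqr v : norm_l2 v ^+ 2 = \sum_i v 0 i ^+ 2.
Proof. by rewrite sqr_sqrtr// sumr_ge0// => i _; exact: sqr_ge0. Qed.

Lemma proj_deltaE v delta i :
  proj_delta v delta 0 i = if delta i then v 0 i else 0.
Proof. by rewrite !mxE; case: (delta i); rewrite ?mulr1 ?mulr0. Qed.

Lemma norm_l0_delta_vec delta :
  norm_l0 (delta_vec R delta) = (\sum_i delta i)%N.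
Proof.
rewrite /norm_l0 cardsE -sum1_card big_mkcond; apply: eq_bigr => i _.
by rewrite unfold_in mxE pnatr_eq0 eqb0 negbK; case: (delta i).
Qed.

Lemma norm_l0_supp v : norm_l0 (delta_vec R (delta_supp v)) = norm_l0 v.
Proof.
rewrite norm_l0_delta_vec /norm_l0 cardsE -sum1_card [RHS]big_mkcond.
by apply: eq_bigr => i _; rewrite ffunE unfold_in; case: eqP.
Qed.

Lemma norm_l0_delta_vec_le delta : (norm_l0 (delta_vec R delta) <= p)%N.
Proof. by rewrite /norm_l0 -[leqRHS]card_ord max_card. Qed.

Lemma prod_delta (a : R) delta :
  \prod_i (if delta i then a else 1) = a ^+ norm_l0 (delta_vec R delta).
Proof.
rewrite norm_l0_delta_vec -prodrXr; apply: eq_bigr => i _.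
by case: (delta i).
Qed.

Lemma norm_l1_split v delta :
  norm_l1 v = norm_l1 (proj_delta v delta)
    + norm_l1 (proj_delta v (delta_compl delta)).
Proof.
rewrite /norm_l1 -big_split; apply: eq_bigr => i _ /=.
by rewrite !proj_deltaE ffunE; case: (delta i); rewrite normr0 ?addr0 ?add0r.
Qed.

Lemma norm_l1_ge0 v : 0 <= norm_l1 v.
Proof. by apply: sumr_ge0. Qed.

Lemma inner_le_norm v1 v2 : inner v1 v2 <= norm_linf v1 * norm_l1 v2.
Proof.
rewrite /inner /norm_l1 mulr_sumr; apply: ler_sum => i _.
apply: le_trans (ler_norm _) _; rewrite normrM ler_wpM2r//.
rewrite /norm_linf /Num.norm/= mx_normrE.
exact: (le_bigmax _ (fun ij => `|v1 ij.1 ij.2|) (0, i)).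
Qed.

(** Cauchy-Schwarz between |v| * delta and delta. *)
Lemma norm_l1_proj_le v delta :
  norm_l1 (proj_delta v delta) <=
  Num.sqrt (norm_l0 (delta_vec R delta))%:R * norm_l2 (proj_delta v delta).
Proof.
set x := norm_l2 _; set k := norm_l0 _.
have x0 : 0 <= x by exact: sqrtr_ge0.
have xE : x ^+ 2 = \sum_i proj_delta v delta 0 i ^+ 2 by exact: norm_l2_sqr.
rewrite -ler_sqr ?nnegrE ?mulr_ge0 ?norm_l1_ge0 ?sqrtr_ge0//.
rewrite exprMn sqr_sqrtr// xE; set S := norm_l1 _; set Q := \sum_i _.
have [k0|k0] := posnP k.
  suff -> : S = 0 by rewrite expr0n mulr_ge0//= sumr_ge0// => i _; exact: sqr_ge0.
  move: k0; rewrite /k norm_l0_delta_vec => /eqP; rewrite sum_nat_eq0 => /forallP d0.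
  by rewrite /S /norm_l1 big1// => i _; rewrite proj_deltaE; move: (d0 i);
    case: (delta i); rewrite ?normr0.
rewrite -subr_ge0 -(pmulr_rge0 _ (x := k%:R)) ?ltr0n//.
(* expand the sum of the squares of k (|v| delta)_i - S delta_i *)
suff <- : \sum_i (k%:R * `|proj_delta v delta 0 i| - S * (delta i)%:R) ^+ 2 =
    k%:R * (k%:R * Q - S ^+ 2) by apply: sumr_ge0 => i _; exact: sqr_ge0.
transitivity (\sum_i (k%:R ^+ 2 * proj_delta v delta 0 i ^+ 2
    - 2 * k%:R * S * `|proj_delta v delta 0 i| + S ^+ 2 * (delta i)%:R)).
  apply: eq_bigr => i _; rewrite proj_deltaE; case: (delta i).
    by rewrite -(real_normK (num_real (v 0 i))) /= mulr1; ring.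
  by rewrite normr0 /=; ring.
rewrite !big_split/= sumrN -!mulr_sumr -/Q -/(norm_l1 _) -/S -natr_sum.
by rewrite -norm_l0_delta_vec -/k; ring.
Qed.

End vector_lemmas.

(** * Lower bound on the normalizing constant *)

Section quasi_posterior_bounds.
Variables (R : realType) (p : nat) (Zt : Type).
Variables (ell : 'rV[R]_p -> Zt -> R) (rho0 rho1 : R).
Variable omega : {ffun 'I_p -> bool} -> R.
Hypotheses (rho0_gt0 : 0 < rho0) (rho1_gt0 : 0 < rho1).
Hypothesis omega_gt0 : forall delta, 0 < omega delta.
Implicit Types (z : Zt) (delta : {ffun 'I_p -> bool}) (theta v : 'rV[R]_p).

Definition precision delta (i : 'I_p) : R := if delta i then rho1 else rho0.

(** The prior density of theta given delta, regrouped by coordinates: the form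
    to which the product integrals apply. *)
Definition prior_gauss delta theta : R :=
  \prod_i gauss (precision delta i) (theta 0 i).

Lemma precision_gt0 delta i : 0 < precision delta i.
Proof. by rewrite /precision; case: ifP. Qed.

Lemma prior_gauss_ge0 delta theta : 0 <= prior_gauss delta theta.
Proof. by apply: prodr_ge0 => i _; exact: gauss_ge0. Qed.

Lemma qp_densityE z delta theta :
  qp_density ell rho0 rho1 omega z delta theta =
  expR (ell (proj_delta theta delta) z) * omega delta
    * prior_gauss delta theta.
Proof.
rewrite /qp_density -!mulrA; congr (_ * (_ * _)).
set k := norm_l0 _.
have powE (a : R) n : 0 <= a -> a `^ (n%:R / 2) = Num.sqrt a ^+ n.
  move=> a0; rewrite mulrC powRrM powR12_sqrt// powR_mulrn// sqrtr_ge0//.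
have pi2 : 0 < 2 * pi :> R by rewrite mulr_gt0// pi_gt0.
rewrite -natrB ?norm_l0_delta_vec_le// !powE ?divr_ge0// ?ltW//.
rewrite mulrA -expRD /prior_gauss /gauss big_split /= -expR_sum.
congr (_ * expR _).
  rewrite (eq_bigr (fun i => (if delta i then Num.sqrt (rho1 / (2 * pi)) else 1) *
     (if delta_compl delta i then Num.sqrt (rho0 / (2 * pi)) else 1))).
    rewrite big_split /= !prod_delta; congr (_ * _ ^+ _).
    rewrite /k !norm_l0_delta_vec; apply/eqP; rewrite -(eqn_add2l (\sum_i delta i)).
    rewrite subnKC; last first.
      by rewrite -(@norm_l0_delta_vec R p) norm_l0_delta_vec_le.
    rewrite -big_split/= (eq_bigr (fun=> 1%N)).
      by rewrite sum1_card card_ord.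
    by move=> i _; rewrite ffunE; case: (delta i).
  by move=> i _; rewrite /precision ffunE; case: (delta i); rewrite ?mulr1 ?mul1r.
rewrite !norm_l2_sqr !mulr_sumr -big_split; apply: eq_bigr => i _ /=.
by rewrite !mxE /precision; case: (delta i) => /=; field.
Qed.

Lemma qp_density_ge0 z delta theta :
  0 <= qp_density ell rho0 rho1 omega z delta theta.
Proof.
by rewrite qp_densityE !mulr_ge0 ?expR_ge0 ?prior_gauss_ge0// ltW.
Qed.

(** Of the sum over models only the true one is kept.  There the likelihood is
    at least exp (ell theta_star) times a product of tilts by concave
    quadratics, coordinate by coordinate, so the integral is bounded below by
    a product of one-dimensional ones. *)
Lemma qp_mass_ge z (theta_star : 'rV[R]_p) (rhobar kappabar : R) :
  0 < kappabar ->
  event0 ell rho0 rho1 omega theta_star rhobar kappabar z ->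
  ((expR (ell theta_star z) * omega (delta_supp theta_star)
     * (Num.sqrt (rho1 / (rho1 + kappabar)) ^+ norm_l0 theta_star
        * expR (- (rho1 / 2) * norm_l2 theta_star ^+ 2)))%:E
   <= qp_mass ell rho0 rho1 omega z setT)%E.
Proof.
move=> kappa0 [_ _ Hz]; set ds := delta_supp theta_star.
rewrite /qp_mass (bigD1 ds)//=; apply: (@le_trans _ _
  (\int[lebesgue_tuple R p]_t
     (qp_density ell rho0 rho1 omega z ds (vec_of_tuple t))%:E)%E); last first.
  apply: leeDl; apply: sume_ge0 => delta _; apply: integral_ge0 => t _.
  by rewrite lee_fin qp_density_ge0.
pose G := gradient (ell^~ z) theta_star.
pose sq := Num.sqrt (rho1 / (rho1 + kappabar)).
pose c i := if ds i then sq * expR (- (rho1 / 2) * theta_star 0 i ^+ 2) else 1.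
pose tau i := if ds i then rho1 + kappabar else rho0.
pose m i := if ds i then
  theta_star 0 i + (G 0 i - rho1 * theta_star 0 i) / (rho1 + kappabar) else 0.
have c0 i : 0 <= c i by rewrite /c; case: ifP => // _;
  rewrite mulr_ge0 ?sqrtr_ge0 ?expR_ge0.
have -> : sq ^+ norm_l0 theta_star * expR (- (rho1 / 2) * norm_l2 theta_star ^+ 2) =
    \prod_i c i.
  rewrite -norm_l0_supp -/ds -prod_delta norm_l2_sqr mulr_sumr expR_sum -big_split.
  apply: eq_bigr => i _ /=; rewrite /c /ds ffunE; case: eqP => //= ->.
  by rewrite expr0n mulr0 expR0 mulr1.
have A0 : 0 <= expR (ell theta_star z) * omega ds by rewrite mulr_ge0 ?expR_ge0// ltW.
rewrite -(@integral_prod_gauss R p _ c tau m)//; last first.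
  by move=> i; rewrite /tau; case: ifP => // _; exact: addr_gt0.
apply: le_integral_nonneg => t; rewrite lee_fin.
  rewrite mulr_ge0// prodr_ge0// => i _; by rewrite mulr_ge0 ?gauss_ge0.
set theta := vec_of_tuple t.
have tE i : tnth t i = theta 0 i by rewrite mxE.
rewrite qp_densityE.
pose h := proj_delta theta ds - theta_star.
pose e i := expR (G 0 i * h 0 i - kappabar / 2 * h 0 i ^+ 2).
have ellge : expR (ell theta_star z) * \prod_i e i <= expR (ell (proj_delta theta ds) z).
  rewrite -expR_sum -expRD ler_expR.
  have := Hz (proj_delta theta ds) (ex_intro2 _ _ theta I erefl).
  rewrite /lin_remainder -/h norm_l2_sqr => hz.
  have -> : \sum_i (G 0 i * h 0 i - kappabar / 2 * h 0 i ^+ 2) =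
      inner G h - kappabar / 2 * \sum_i h 0 i ^+ 2.
    by rewrite sumrB -mulr_sumr.
  by move: hz; rewrite -/G; lra.
apply: (@le_trans _ _ (expR (ell theta_star z) * (\prod_i e i) * omega ds *
   prior_gauss ds theta)); last first.
  by rewrite ler_wpM2r ?prior_gauss_ge0// ler_wpM2r// ltW.
rewrite [leRHS](_ : _ = expR (ell theta_star z) * omega ds *
  ((\prod_i e i) * prior_gauss ds theta)); last by ring.
rewrite ler_wpM2l// -big_split; apply: ler_prod => i _.
rewrite mulr_ge0 ?gauss_ge0//= tE /e /c /tau /m /precision.
have hE : h 0 i = if ds i then theta 0 i - theta_star 0 i else 0.
  have -> : h 0 i = proj_delta theta ds 0 i - theta_star 0 i by rewrite !mxE.
  rewrite proj_deltaE /ds ffunE; case: eqP => //= ->.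
  by rewrite subr0.
rewrite hE; case: (ds i); first exact: tilted_gauss_ge.
by rewrite expr0n/= !(mulr0, subr0) expR0.
Qed.

End quasi_posterior_bounds.

(** * Upper bound on the likelihood ratio of one model *)

Section upper_bounds.
Variables (R : realType) (p : nat).
Implicit Types (v theta : 'rV[R]_p) (delta : {ffun 'I_p -> bool}).

(** Only the coordinates in delta and off the true support contribute to the
    exponential.  The factor exp (1/2 + 2 rho1) >= 1 is granted to every
    coordinate of delta all the same, to get a bound that depends on the size
    of delta only. *)
Lemma prior_laplace_le (rho0 rho1 a : R) (theta_star : 'rV[R]_p) delta :
  0 < rho0 -> 0 < rho1 ->
  (\int[lebesgue_tuple R p]_t
     (expR (a + 4 / 7 * rho1 *
        norm_l1 (proj_delta (proj_delta (vec_of_tuple t) delta - theta_star)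
                            (delta_compl (delta_supp theta_star))))
      * prior_gauss rho0 rho1 delta (vec_of_tuple t))%:E
   <= (expR a * expR (1 / 2 + 2 * rho1) ^+ norm_l0 (delta_vec R delta))%:E)%E.
Proof.
move=> rho00 rho10; set ds := delta_supp theta_star.
have B1 : 1 <= expR (1 / 2 + 2 * rho1) by rewrite -[leLHS]expR0 ler_expR; lra.
rewrite -prod_delta; set B := expR (1 / 2 + _) in B1 *.
pose off i := delta i && ~~ ds i.
pose tau i := if off i then rho1 / 2 else precision rho0 rho1 delta i.
rewrite -(@integral_prod_gauss R p _ (fun i => if delta i then B else 1) tau
  (fun=> 0)) ?expR_ge0//; last 2 first.
- by move=> i; case: ifP => // _; exact: expR_ge0.
- by move=> i; rewrite /tau; case: ifP => // _;
    [exact: divr_gt0|exact: precision_gt0].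
apply: le_integral_nonneg => t; rewrite lee_fin.
  by rewrite mulr_ge0 ?expR_ge0 ?prior_gauss_ge0.
set theta := vec_of_tuple t.
have tE i : tnth t i = theta 0 i by rewrite mxE.
rewrite expRD -mulrA ler_wpM2l ?expR_ge0//.
rewrite /norm_l1 mulr_sumr expR_sum /prior_gauss -big_split.
apply: ler_prod => i _; rewrite /= mulr_ge0 ?expR_ge0 ?gauss_ge0//= tE subr0.
have -> : proj_delta (proj_delta theta delta - theta_star) (delta_compl ds) 0 i =
    if off i then theta 0 i else 0.
  rewrite proj_deltaE ffunE.
  have -> : (proj_delta theta delta - theta_star) 0 i =
    proj_delta theta delta 0 i - theta_star 0 i by rewrite !mxE.
  rewrite proj_deltaE /off /ds ffunE; case: eqP => [->|_]/=; last first.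
    by rewrite andbF.
  by rewrite subr0 andbT.
rewrite /tau /off /precision; case: (delta i) => /=; last first.
  by rewrite normr0 mulr0 expR0.
case: (ds i) => /=; last exact: laplace_gauss_le.
by rewrite normr0 mulr0 expR0 ler_wpM2r// gauss_ge0.
Qed.

(** The exponent of the moment hypothesis has only the fraction
    1 - rho1 / rhobar of the first-order term.  The rest, (rho1 / rhobar)
    <G, h>, is at most (rho1 / 2) |h|_1 by duality of the l_infinity and l_1
    norms and the bound rhobar / 2 on the gradient. *)
Lemma log_ratio_le (Zt : Type) (ell : 'rV[R]_p -> Zt -> R) rho0 rho1 omega
    theta_star (rhobar kappabar : R) z v :
  0 < rho1 -> 0 < rhobar ->
  event0 ell rho0 rho1 omega theta_star rhobar kappabar z ->
  ell v z - ell theta_star z <=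
    rho1 / 2 * norm_l1 (v - theta_star) +
    (lin_remainder ell theta_star v z + (1 - rho1 / rhobar) *
       inner (gradient (ell^~ z) theta_star) (v - theta_star)).
Proof.
move=> rho10 rhobar0 [_ Hgrad _]; rewrite /lin_remainder.
set h := v - theta_star; set G := gradient _ _.
suff : rho1 / rhobar * inner G h <= rho1 / 2 * norm_l1 h by lra.
have -> : rho1 / 2 * norm_l1 h = rho1 / rhobar * (rhobar / 2 * norm_l1 h).
  by field; rewrite gt_eqF.
rewrite ler_wpM2l ?divr_ge0 ?(ltW rho10) ?(ltW rhobar0)//.
by apply: le_trans (inner_le_norm _ _) _; rewrite ler_wpM2r ?norm_l1_ge0.
Qed.

(** In the cone, |on|_1 <= sqrt s * |on|_2 and the definition of [a] absorb
    (rho1 / 2) |on|_1 into a / 2, the value |on|_2 = 0 being apart.  Out of the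
    cone, |on|_1 <= |off|_1 / 7.  The constant is 4/7 = (1/2) (1 + 1/7). *)
Lemma cone_exponent_le (r : R -> R) (rho1 a : R) delta v :
  let on := proj_delta v delta in
  let off := proj_delta v (delta_compl delta) in
  0 < rho1 -> 0 <= a -> 0 <= r 0 ->
  (forall x, 0 < x ->
    - a <= r x - 4 * rho1 * Num.sqrt (norm_l0 (delta_vec R delta))%:R * x) ->
  rho1 / 2 * norm_l1 v +
    (if norm_l1 off <= 7 * norm_l1 on then - (1 / 2) * r (norm_l2 on) else 0)
  <= a / 2 + 4 / 7 * rho1 * norm_l1 off.
Proof.
move=> on off rho10 a0 r0 ar; rewrite (norm_l1_split v delta) -/on -/off.
have on0 := norm_l1_ge0 on; have off0 := norm_l1_ge0 off.
have ron0 := mulr_ge0 (ltW rho10) on0.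
have roff0 := mulr_ge0 (ltW rho10) off0.
case: ifPn => [_|]; last first.
  rewrite -ltNge => /ltW /(ler_wpM2l (ltW rho10)); lra.
have := norm_l1_proj_le v delta; rewrite -/on.
set x := norm_l2 on; set s := Num.sqrt _.
move/(ler_wpM2l (ltW rho10)) => onx.
have : 0 <= x by exact: sqrtr_ge0.
rewrite le_eqVlt => /predU1P[x0|/ar]; last by rewrite -/s; lra.
by move: onx; rewrite -x0 mulr0 mulr0; lra.
Qed.

End upper_bounds.

(** * Expectation of the posterior mass *)

Section expectation.
Variables (R : realType) (p : nat).
Notation M := (measurableTypeR R).
Context (dZ : measure_display) (Zt : measurableType dZ).
Context (dOmega : measure_display) (Omega : measurableType dOmega).
Variables (P : probability Omega R) (Z : {mfun Omega >-> Zt}).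
Variables (ell : 'rV[R]_p -> Zt -> R) (theta_star : 'rV[R]_p).
Hypothesis ell_meas : measurable_fun [set: p.-tuple M * Zt]
    (fun tz => ell (vec_of_tuple tz.1) tz.2).
Variables (E : set Zt) (mE : measurable E).
Implicit Types (delta : {ffun 'I_p -> bool}).

Definition restricted_ratio (v : 'rV[R]_p) (w : Omega) : R :=
  \1_E (Z w) * expR (ell v (Z w) - ell theta_star (Z w)).

Lemma restricted_ratio_ge0 v w : 0 <= restricted_ratio v w.
Proof. by rewrite mulr_ge0 ?expR_ge0. Qed.

(** Joint measurability in the parameter and the sample point, the condition
    for exchanging expectation and prior average. *)
Lemma measurable_restricted_ratio_proj delta :
  measurable_fun [set: p.-tuple M * Omega]
    (fun tw => restricted_ratio (proj_delta (vec_of_tuple tw.1) delta) tw.2).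
Proof.
have ZE : measurable_fun setT (fun tw : p.-tuple M * Omega => Z tw.2).
  exact: measurableT_comp.
have meas (f : p.-tuple M * Omega -> p.-tuple M) : measurable_fun setT f ->
    measurable_fun setT (fun tw => ell (vec_of_tuple (f tw)) (Z tw.2)).
  move=> mf.
  have mfZ : measurable_fun setT (fun tw => (f tw, Z tw.2)).
    exact/measurable_fun_pairP.
  exact: (measurableT_comp ell_meas mfZ).
apply: measurable_funM.
  by apply: measurableT_comp ZE; exact: measurable_indic.
apply: measurableT_comp => //; apply: measurable_funB.
  pose f (tw : p.-tuple M * Omega) : p.-tuple M :=
    [tuple if delta i then tnth tw.1 i else 0 | i < p].
  have vf tw : vec_of_tuple (f tw) = proj_delta (vec_of_tuple tw.1) delta.
    by apply/rowP => i; rewrite proj_deltaE !mxE tnth_mktuple.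
  rewrite (_ : (fun _ => _) = (fun tw => ell (vec_of_tuple (f tw)) (Z tw.2))).
    apply: meas; apply/measurable_fun_tnthP => i.
    rewrite (_ : _ \o _ = fun tw => if delta i then tnth tw.1 i else 0); last first.
      by apply/funext => tw /=; rewrite tnth_mktuple.
    case: (delta i) => //.
    by apply: measurableT_comp (measurable_tnth i) _.
  by apply/funext => tw; rewrite vf.
pose s : p.-tuple M := [tuple theta_star 0 i | i < p].
have -> : theta_star = vec_of_tuple s.
  by apply/rowP => i; rewrite !mxE tnth_mktuple.
exact: meas.
Qed.

Definition marginal_ratio (rho0 rho1 : R) delta (w : Omega) : \bar R :=
  (\int[lebesgue_tuple R p]_t
     (restricted_ratio (proj_delta (vec_of_tuple t) delta) w
      * prior_gauss rho0 rho1 delta (vec_of_tuple t))%:E)%E.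

Section marginal.
Variables (rho0 rho1 : R) (rho0_gt0 : 0 < rho0) (rho1_gt0 : 0 < rho1).

Let integrand delta (tw : p.-tuple M * Omega) : \bar R :=
  (restricted_ratio (proj_delta (vec_of_tuple tw.1) delta) tw.2
   * prior_gauss rho0 rho1 delta (vec_of_tuple tw.1))%:E.

Let integrand_ge0 delta tw : (0 <= integrand delta tw)%E.
Proof. by rewrite lee_fin mulr_ge0 ?restricted_ratio_ge0 ?prior_gauss_ge0. Qed.

Lemma measurable_prior_gauss delta :
  measurable_fun setT
    (fun t : p.-tuple M => prior_gauss rho0 rho1 delta (vec_of_tuple t)).
Proof.
pose f (i : 'I_p) x := gauss (precision rho0 rho1 delta i) (x - 0).
rewrite (_ : (fun _ => _) = (fun t : p.-tuple M => \prod_i f i (tnth t i))).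
  by apply: (@measurable_prod_tnth R p f) => i; exact: measurable_gauss.
apply/funext => t; apply: eq_bigr => i _.
by rewrite /f subr0 mxE.
Qed.

Let measurable_integrand delta : measurable_fun setT (integrand delta).
Proof.
apply/measurable_EFinP; apply: measurable_funM.
  exact: measurable_restricted_ratio_proj.
exact: (measurableT_comp (measurable_prior_gauss delta) (@measurable_fst _ _ _ _)).
Qed.

Lemma marginal_ratio_ge0 delta w : (0 <= marginal_ratio rho0 rho1 delta w)%E.
Proof. by apply: integral_ge0 => t _; exact: (integrand_ge0 delta (t, w)). Qed.

Lemma measurable_marginal_ratio delta :
  measurable_fun setT (marginal_ratio rho0 rho1 delta).
Proof.
exact: (measurable_fun_fubini_tonelli_G (m1 := lebesgue_tuple R p)
  (integrand delta)).
Qed.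

(** Tonelli turns a bound on the expected likelihood ratio at each fixed
    parameter into one on the expectation of its prior average. *)
Lemma expectation_marginal_ratio_le (a : R) delta :
  (forall v, Rdelta delta v ->
    \int[P]_w (restricted_ratio v w)%:E <=
    (expR (a + 4 / 7 * rho1 * norm_l1
      (proj_delta (v - theta_star) (delta_compl (delta_supp theta_star)))))%:E)%E ->
  (\int[P]_w marginal_ratio rho0 rho1 delta w <=
   (expR a * expR (1 / 2 + 2 * rho1) ^+ norm_l0 (delta_vec R delta))%:E)%E.
Proof.
move=> ratio_le; rewrite /marginal_ratio.
have := fubini_tonelli (m1 := lebesgue_tuple R p) (m2 := P) (integrand delta)
  (measurable_integrand delta) (integrand_ge0 delta).
rewrite /integrand /= => <-.
apply: le_trans (prior_laplace_le _ theta_star delta rho0_gt0 rho1_gt0).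
apply: le_integral_nonneg => t.
  by apply: integral_ge0 => w _; exact: (integrand_ge0 delta (t, w)).
under eq_integral do rewrite EFinM muleC.
rewrite ge0_integralZl_EFin ?prior_gauss_ge0//.
- rewrite mulrC EFinM; apply: lee_wpmul2l.
    by rewrite lee_fin prior_gauss_ge0.
  by apply: ratio_le; exists (vec_of_tuple t).
- by move=> w _; rewrite lee_fin restricted_ratio_ge0.
- apply/measurable_EFinP.
  have mt : measurable_fun setT (fun w : Omega => (t, w)).
    by apply/measurable_fun_pairP; split => /=;
      [exact: measurable_cst|exact: measurable_id].
  exact: (measurableT_comp (measurable_restricted_ratio_proj delta) mt).
Qed.

Variable omega : {ffun 'I_p -> bool} -> R.
Hypothesis omega_gt0 : forall delta, 0 < omega delta.
Variables (rhobar kappabar : R) (kappabar_gt0 : 0 < kappabar).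
Hypothesis EE0 : E `<=` event0 ell rho0 rho1 omega theta_star rhobar kappabar.

(* The lower bound on the normalizing constant, without the likelihood of
   theta_star, which is part of the likelihood ratio. *)
Let evidence_lb : R :=
  omega (delta_supp theta_star)
    * (Num.sqrt (rho1 / (rho1 + kappabar)) ^+ norm_l0 theta_star
       * expR (- (rho1 / 2) * norm_l2 theta_star ^+ 2)).

Let evidence_lb_gt0 : 0 < evidence_lb.
Proof.
rewrite !mulr_gt0 ?expR_gt0// exprn_gt0// sqrtr_gt0 divr_gt0//.
exact: addr_gt0.
Qed.

Lemma quasi_posterior_le (Q : pred {ffun 'I_p -> bool}) w :
  ((\1_E (Z w))%:E * quasi_posterior ell rho0 rho1 omega (Z w)
     [set dt | Q dt.1]
   <= \sum_(delta | Q delta)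
        (omega delta / evidence_lb)%:E * marginal_ratio rho0 rho1 delta w)%E.
Proof.
have sum0 : (0 <= \sum_(delta | Q delta)
    (omega delta / evidence_lb)%:E * marginal_ratio rho0 rho1 delta w)%E.
  apply: sume_ge0 => delta _; rewrite mule_ge0 ?marginal_ratio_ge0//.
  by rewrite lee_fin divr_ge0// ltW.
rewrite indicE; have [wE|wE] := boolP (Z w \in E); last by rewrite mul0e.
rewrite mul1e; have E0w : event0 ell rho0 rho1 omega theta_star rhobar kappabar (Z w).
  by apply: EE0; rewrite inE in wE.
have := qp_mass_ge rho0_gt0 rho1_gt0 omega_gt0 kappabar_gt0 E0w.
rewrite -mulrA -/evidence_lb => mass_ge.
have [/andP[D0 Doo] _ _] := E0w.
set L := expR _ * _ in mass_ge.
have L0 : 0 < L by rewrite mulr_gt0 ?expR_gt0.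
rewrite /quasi_posterior; apply: (@le_trans _ _
  (qp_mass ell rho0 rho1 omega (Z w) [set dt | Q dt.1] * (L^-1)%:E)%E).
  apply: lee_wpmul2l.
    apply: sume_ge0 => delta _; apply: integral_ge0 => t _.
    by rewrite lee_fin qp_density_ge0.
  rewrite -[(L^-1)%:E](_ : (L%:E)^-1 = _)%E; last by rewrite inver gt_eqF.
  by rewrite lee_pV2 ?inE//; [exact: ltW|rewrite lee_fin ltW].
rewrite /qp_mass muleC ge0_sume_distrr; last first.
  move=> delta _; apply: integral_ge0 => t _.
  by rewrite lee_fin qp_density_ge0.
rewrite [leRHS]big_mkcond /=; apply: lee_sum => delta _.
case: ifPn => [Qd|/negbTE Qd]; last first.
  rewrite (_ : [set _ | _] = set0) ?integral_set0 ?mule0//.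
  by apply/seteqP; split => // t /=; rewrite Qd.
rewrite (_ : [set _ | _] = setT); last by apply/seteqP; split.
rewrite (_ : \int[_]_(_ in _) _ = (expR (ell theta_star (Z w)) * omega delta)%:E *
    marginal_ratio rho0 rho1 delta w)%E; last first.
  rewrite -ge0_integralZl_EFin//.
  - apply: eq_integral => t _; rewrite qp_densityE// /restricted_ratio indicE wE.
    rewrite -EFinM mul1r expRB; congr (_%:E).
    by field; rewrite gt_eqF// expR_gt0.
  - by move=> t _; exact: (integrand_ge0 delta (t, w)).
  - have mt : measurable_fun setT (fun t : p.-tuple M => (t, w)).
      by apply/measurable_fun_pairP; split => /=;
        [exact: measurable_id|exact: measurable_cst].
    exact: (measurableT_comp (measurable_integrand delta) mt).
  - by rewrite mulr_ge0 ?expR_ge0// ltW.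
rewrite muleA -EFinM (_ : L^-1 * _ = omega delta / evidence_lb)//.
by rewrite /L; field; rewrite !gt_eqF ?expR_gt0.
Qed.

Lemma expectation_quasi_posterior_le (a : R) (Q : pred {ffun 'I_p -> bool}) :
  (forall delta v, Rdelta delta v ->
    \int[P]_w (restricted_ratio v w)%:E <=
    (expR (a + 4 / 7 * rho1 * norm_l1
      (proj_delta (v - theta_star) (delta_compl (delta_supp theta_star)))))%:E)%E ->
  (\int[P]_w ((\1_E (Z w))%:E *
     quasi_posterior ell rho0 rho1 omega (Z w) [set dt | Q dt.1])
   <= (\sum_(delta | Q delta) omega delta / evidence_lb *
        (expR a * expR (1 / 2 + 2 * rho1) ^+ norm_l0 (delta_vec R delta)))%:E)%E.
Proof.
move=> ratio_le.
have ev0 delta : 0 <= omega delta / evidence_lb by rewrite divr_ge0// ltW.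
apply: (@le_trans _ _ (\int[P]_w (\sum_(delta | Q delta)
        (omega delta / evidence_lb)%:E * marginal_ratio rho0 rho1 delta w))%E).
  apply: le_integral_nonneg => w; last exact: quasi_posterior_le.
  apply: mule_ge0; first by rewrite lee_fin.
  rewrite /quasi_posterior mule_ge0 ?inve_ge0//; apply: sume_ge0 => delta _;
    by apply: integral_ge0 => t _; rewrite lee_fin qp_density_ge0.
under eq_integral do rewrite -big_filter.
rewrite ge0_integral_sum//; last 2 first.
- by move=> delta; apply: measurable_funeM; exact: measurable_marginal_ratio.
- by move=> delta w _; rewrite mule_ge0 ?marginal_ratio_ge0 ?lee_fin.
rewrite big_filter -sumEFin; apply: lee_sum => delta _.
rewrite ge0_integralZl_EFin//.
- rewrite [leRHS]EFinM lee_wpmul2l ?lee_fin//.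
  by apply: expectation_marginal_ratio_le; exact: ratio_le.
- by move=> w _; exact: marginal_ratio_ge0.
- exact: measurable_marginal_ratio.
Qed.

End marginal.

End expectation.

(** * Summation over models and the dimension bound *)

(** Over all models the sum factorizes into (1 + 1/p)^p <= e <= 3, and the empty
    model, which [Q] excludes, accounts for 1. *)
Lemma sum_delta_powers_le (R : realType) (p : nat)
    (Q : pred {ffun 'I_p -> bool}) : (0 < p)%N ->
  (forall delta, Q delta -> (0 < norm_l0 (delta_vec R delta))%N) ->
  \sum_(delta | Q delta) p%:R^-1 ^+ norm_l0 (delta_vec R delta) <= 2 :> R.
Proof.
move=> p0 Q0; set x : R := p%:R^-1.
have x0 : 0 <= x by rewrite invr_ge0.
have total : \sum_(delta : {ffun 'I_p -> bool})
    x ^+ norm_l0 (delta_vec R delta) <= 3.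
  under eq_bigr do rewrite -prod_delta.
  rewrite -(bigA_distr_bigA (fun i (b : bool) => if b then x else 1)).
  rewrite (eq_bigr (fun=> 1 + x)); last first.
    by move=> i _; rewrite big_bool addrC.
  rewrite prodr_const card_ord; apply: le_trans (expR1_le3 R).
  rewrite (_ : expR 1 = expR x ^+ p); last first.
    by rewrite -expRM_natl mulfV// pnatr_eq0 -lt0n.
  by apply: lerXn2r; rewrite ?nnegrE ?expR_ge0 ?addr_ge0 ?expR_ge1Dx.
pose d0 : {ffun 'I_p -> bool} := [ffun=> false].
have d00 : norm_l0 (delta_vec R d0) = 0%N.
  by rewrite norm_l0_delta_vec big1// => i _; rewrite ffunE.
rewrite (@bigD1 _ _ _ _ d0 xpredT)//= d00 expr0 in total.
apply: (@le_trans _ _ (\sum_(delta | delta != d0)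
    x ^+ norm_l0 (delta_vec R delta))); last by lra.
rewrite big_mkcond [leRHS]big_mkcond; apply: ler_sum => delta _.
case: (boolP (Q delta)) => [/Q0|_]; last by case: ifP => // _; exact: exprn_ge0.
by case: eqP => [->|//]; rewrite d00.
Qed.

(** A rate function is o(x) at 0.  Taken with c = 4 rho1 sqrt s, this shows that
    the infimum defining a0 is nonpositive, so that a0 >= 0. *)
Lemma rate_function_le_linear (R : realType) (r : R -> R) (c : R) :
  rate_function r -> 0 < c -> exists2 x, 0 < x & r x <= c * x.
Proof.
move=> [_ _ _ _ r0] c0.
have near_c : \forall x \near 0^'+, r x / x < c by exact: (cvgr_lt _ r0).
have near_0 : \forall x \near (0 : R)^'+, 0 < x by exact: nbhs_right_gt.
have [x [rx x0]] : exists x, r x / x < c /\ 0 < x.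
  by apply: (@filter_ex _ (0 : R)^'+); exact: filterI near_c near_0.
by exists x => //; rewrite -ler_pdivrMr// ltW.
Qed.

Section prior_ratio.
Variables (R : realType) (p : nat).
Variables (u q : R).
Hypotheses (p1 : (1 < p)%N) (q01 : 0 < q < 1).
Hypothesis qu : q / (1 - q) = 1 / p%:R `^ (u + 1).

Lemma prior_ratioE k l : (k <= p)%N -> (l <= p)%N ->
  q ^+ k * (1 - q) ^+ (p - k) / (q ^+ l * (1 - q) ^+ (p - l)) =
  expR (- ((u + 1) * ln p%:R) * (k%:R - l%:R)).
Proof.
move=> kp lp; have /andP[q0 q1] := q01.
have nq0 : 1 - q != 0 by rewrite subr_eq0 gt_eqF.
have qE n : (n <= p)%N -> q ^+ n * (1 - q) ^+ (p - n) =
    (1 - q) ^+ p * expR (- ((u + 1) * ln p%:R) * n%:R).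
  move=> np; rewrite mulrC [_ * n%:R]mulrC expRM_natl expRN.
  have -> : expR ((u + 1) * ln p%:R) = p%:R `^ (u + 1) :> R.
    by rewrite /powR pnatr_eq0 -[X in X == 0%N]prednK// ltnW.
  rewrite -[_^-1]div1r -qu expr_div_n -{2}(subnK np) exprD.
  by field; rewrite expf_neq0.
rewrite (qE _ kp) (qE _ lp) mulrBr expRD expRN.
by field; rewrite gt_eqF ?expR_gt0// expf_neq0.
Qed.

End prior_ratio.

(** The accounting of exponents, with lp = log p, k the size of a model, n2 the
    squared norm of theta_star and g = log (1 + kappabar / rho1).  The term
    (1/2 + 2 rho1) k is split along k = s + (k - s): the first part enters the
    assumption on c0, the second is at most (u / 2) lp (k - s).  This leaves
    c0 s lp - (u / 2 + 1) lp (k - s), and the lower bound on k says that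
    (u / 2) (k - s) >= s (1 + c0) + u j / 2. *)
Lemma posterior_exponent_le (R : realType) (u c0 lp rho1 n2 a g s k j : R) :
  0 < u -> 0 < lp -> 0 < s -> 0 < rho1 -> 0 <= n2 -> 0 <= c0 -> 0 <= j ->
  1 / 2 + 2 * rho1 <= u / 2 * lp ->
  s * (1 / 2 + 2 * rho1) + s / 2 * g + a / 2 + 2 * rho1 * n2 <= c0 * s * lp ->
  s * (1 + 2 * (1 + c0) / u) + j <= k ->
  - ((u + 1) * lp) * (k - s) + s / 2 * g + rho1 / 2 * n2 + a / 2
    + (1 / 2 + 2 * rho1) * k <= - (u * j / 2 * lp) - lp * k.
Proof.
move=> u0 lp0 s0 rho10 n20 c0_ge0 j0 Blp Hc0 Hk.
have Hk' : s * (1 + c0) + u * j / 2 <= u / 2 * (k - s).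
  have -> : s * (1 + c0) + u * j / 2 =
      u / 2 * (s * (1 + 2 * (1 + c0) / u) + j - s) by field; rewrite gt_eqF.
  by rewrite ler_wpM2l ?divr_ge0 ?(ltW u0)// lerD2r.
have ks : 0 <= k - s.
  rewrite -(pmulr_rge0 _ (x := u / 2)) ?divr_gt0//; apply: le_trans Hk'.
  by rewrite addr_ge0 ?mulr_ge0 ?addr_ge0 ?(ltW u0) ?(ltW s0).
have := ler_wpM2r ks Blp; have := ler_wpM2l (ltW lp0) Hk'.
have := mulr_ge0 (ltW rho10) n20; nra.
Qed.

Theorem theorem2 (R : realType)
  (u c0 : R) (hu : 0 < u)
  (p : nat) (hp : (9 <= p)%N)
  (dZ : measure_display) (Zt : measurableType dZ)
  (dz : {sigma_finite_measure set Zt -> \bar R})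
  (ell : 'rV[R]_p -> Zt -> R)
  (ell_meas : measurable_fun [set: p.-tuple (measurableTypeR R) * Zt]
    (fun tz => ell (vec_of_tuple tz.1) tz.2))
  (ell_diff : forall z, thrice_differentiable (ell^~ z))
  (rho0 rho1 : R) (hrho0 : 0 < rho0) (hrho1 : 0 < rho1)
  (dOmega : measure_display) (Omega : measurableType dOmega)
  (P : probability Omega R) (Z : {mfun Omega >-> Zt})
  (fstar : Zt -> R) (fstar_meas : measurable_fun setT fstar)
  (fstar_ge0 : forall z, 0 <= fstar z)
  (Z_density : forall A, measurable A ->
    distribution P Z A = (\int[dz]_(z in A) (fstar z)%:E)%E)
  (theta_star : 'rV[R]_p) (theta_star_neq0 : theta_star != 0)
  (q : R) (hq : 0 < q < 1) (hqu : q / (1 - q) = 1 / p%:R `^ (u + 1))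
  (omega : {ffun 'I_p -> bool} -> R)
  (omegaE : forall delta, omega delta =
    q ^+ norm_l0 (delta_vec R delta) * (1 - q) ^+ (p - norm_l0 (delta_vec R delta)))
  (rhobar kappabar : R) (hrhobar : 0 < rhobar) (hkappabar : 0 < kappabar) :
  let delta_star := delta_supp theta_star in
  let s_star : R := (norm_l0 theta_star)%:R in
  let E0 := event0 ell rho0 rho1 omega theta_star rhobar kappabar in
  (0 < P (Z @^-1` E0))%E ->
  32 * rho1 * norm_linf theta_star <= rhobar ->
  2 * expR (2 * rho1) <= p%:R `^ (u / 2) ->
  forall (r0 : R -> R) (E : set Zt),
  rate_function r0 -> measurable E -> E `<=` E0 ->
  (forall (delta : {ffun 'I_p -> bool}) (v : 'rV[R]_p), Rdelta delta v ->
    let h := v - theta_star in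
    let bound : R :=
      if norm_l1 (proj_delta h (delta_compl delta_star))
           <= 7 * norm_l1 (proj_delta h delta_star)
      then - (1 / 2) * r0 (norm_l2 (proj_delta h delta_star))
      else 0 in
    (lne (\int[P]_w (\1_E (Z w) *
        expR (lin_remainder ell theta_star v (Z w) +
              (1 - rho1 / rhobar) *
                inner (gradient (ell^~ (Z w)) theta_star) h))%:E)
      <= bound%:E)%E) ->
  let a0 : \bar R := (- ereal_inf
    [set (r0 x - 4 * rho1 * Num.sqrt s_star * x)%:E | x in `]0%R, +oo[])%E in
  ((s_star * (1 / 2 + 2 * rho1)
      + s_star / 2 * ln (1 + kappabar / rho1))%:E
    + a0 * (2^-1)%:E
    + (2 * rho1 * norm_l2 theta_star ^+ 2)%:E
    <= (c0 * s_star * ln p%:R)%:E)%E ->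
  forall j : R, 1 <= j ->
  (\int[P]_w ((\1_E (Z w))%:E *
      quasi_posterior ell rho0 rho1 omega (Z w)
        [set dt | (s_star * (1 + 2 * (1 + c0) / u) + j
                     <= (norm_l0 (delta_vec R dt.1))%:R)%R])
    <= (2 / p%:R `^ (u * j / 2))%:E)%E.
Proof.
move=> ds s E0 _ _ hpu r0 E hr0 mE EE0 hmoment a0 hc0 j j1.
have p1 : (1 < p)%N by exact: leq_trans hp.
have p0 : 0 < p%:R :> R by rewrite ltr0n ltnW.
have pn0 : (p%:R : R) != 0 by rewrite gt_eqF.
have lp0 : 0 < ln p%:R :> R by rewrite ln_gt0// ltr1n.
have powE x : p%:R `^ x = expR (x * ln p%:R) :> R by rewrite /powR (negbTE pn0).
have s0 : 0 < s.
  rewrite ltr0n lt0n; apply: contra theta_star_neq0.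
  rewrite -norm_l0_supp norm_l0_delta_vec sum_nat_eq0 => /forallP h.
  apply/eqP/rowP => i; apply/eqP; move: (h i); rewrite ffunE mxE eqb0.
  by rewrite negbK.
have [q0 q1] := andP hq.
have omega_gt0 delta : 0 < omega delta.
  by rewrite omegaE mulr_gt0 ?exprn_gt0// subr_gt0.
(* a0 is a nonnegative real: were it infinite, the assumption on c0 would fail *)
have [A [A0 aE HA]] : exists A : R, [/\ 0 <= A, a0 = A%:E &
    forall x, 0 < x -> - A <= r0 x - 4 * rho1 * Num.sqrt s * x].
  have a0_ge0 : (0 <= a0)%E.
    have c_gt0 : 0 < 4 * rho1 * Num.sqrt s by rewrite !mulr_gt0// sqrtr_gt0.
    have [x x0 rx] := rate_function_le_linear hr0 c_gt0.
    rewrite /a0 leeNr oppe0; apply: (@le_trans _ _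
      (r0 x - 4 * rho1 * Num.sqrt s * x)%:E); last by rewrite lee_fin subr_le0.
    by apply: ereal_inf_lbound; exists x => //=; rewrite in_itv/= x0.
  have a0_lb x : 0 < x -> (- a0 <= (r0 x - 4 * rho1 * Num.sqrt s * x)%:E)%E.
    move=> x0; rewrite /a0 oppeK; apply: ereal_inf_lbound.
    by exists x => //=; rewrite in_itv/= x0.
  case: a0 a0_ge0 a0_lb hc0 => [A|_ _|//].
    by rewrite lee_fin => A0 HA _; exists A; split => // x /HA.
  by rewrite mulyr gtr0_sg ?invr_gt0// mul1e addeC addey// addey.
move: hc0; rewrite aE -EFinM -!EFinD lee_fin => hc0'.
pose g := ln (1 + kappabar / rho1).
have g_arg : 1 <= 1 + kappabar / rho1.
  by rewrite lerDl divr_ge0 ?(ltW hrho1) ?(ltW hkappabar).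
have g0 : 0 <= g by exact: ln_ge0.
have c0_ge0 : 0 <= c0.
  rewrite -(pmulr_lge0 _ (mulr_gt0 s0 lp0)) mulrA; apply: le_trans hc0'.
  have := mulr_ge0 (ltW hrho1) (sqr_ge0 (norm_l2 theta_star)).
  have := mulr_gt0 s0 hrho1; have := mulr_ge0 (ltW s0) g0.
  by rewrite /g; lra.
have ratio_le delta v : Rdelta delta v ->
    (\int[P]_w (restricted_ratio Z ell theta_star E v w)%:E <=
    (expR (A / 2 + 4 / 7 * rho1 * norm_l1
      (proj_delta (v - theta_star) (delta_compl ds))))%:E)%E.
  move=> vdelta; have := hmoment delta v vdelta => /=.
  set b := if _ then _ else _; set Y := (\int[P]_w _)%E => Yb.
  set h := v - theta_star in b Y Yb *.
  have Y0 : (0 <= Y)%E.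
    by apply: integral_ge0 => w _; rewrite lee_fin mulr_ge0 ?expR_ge0.
  have {}Yb : (Y <= (expR b)%:E)%E.
    rewrite -[Y]lneK ?in_itv/= ?Y0 ?leey//.
    by have := Yb; rewrite -lee_expeR.
  set F := (\int[P]_w _)%E.
  pose t := rho1 / 2 * norm_l1 h.
  (* the constant is kept on the left, where the integrand is measurable *)
  have FY : ((expR (- t))%:E * F <= Y)%E.
    rewrite /F -ge0_integralZl_EFin ?expR_ge0//; last 2 first.
    - by move=> w _; rewrite lee_fin restricted_ratio_ge0.
    - apply/measurable_EFinP; case: vdelta => theta _ <-.
      pose t0 : p.-tuple (measurableTypeR R) := [tuple theta 0 i | i < p].
      have <- : vec_of_tuple t0 = theta.
        by apply/rowP => i; rewrite mxE tnth_mktuple.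
      have mt0 : measurable_fun setT (fun w : Omega => (t0, w)).
        by apply/measurable_fun_pairP; split => /=;
          [exact: measurable_cst|exact: measurable_id].
      exact: (measurableT_comp
        (measurable_restricted_ratio_proj Z theta_star ell_meas mE delta) mt0).
    apply: le_integral_nonneg => w.
      by rewrite -EFinM lee_fin mulr_ge0 ?expR_ge0 ?restricted_ratio_ge0.
    rewrite -EFinM lee_fin /restricted_ratio indicE.
    have [wE|_] := boolP (Z w \in E); last by rewrite !mul0r mulr0.
    rewrite !mul1r -expRD ler_expR.
    have := log_ratio_le v hrho1 hrhobar (EE0 _ (set_mem wE)).
    rewrite -/h -/t; lra.
  have {}FY : (F <= (expR (t + b))%:E)%E.
    rewrite expRD EFinM -lee_pdivrMl ?expR_gt0// -expRN.
    exact: le_trans FY Yb.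
  apply: le_trans FY _; rewrite lee_fin ler_expR /t /b.
  apply: cone_exponent_le => //.
  - by case: hr0 => + _ _ _ _; apply.
  - by rewrite norm_l0_supp.
set K := s * _ + j.
pose Q : pred {ffun 'I_p -> bool} :=
  fun delta => K <= (norm_l0 (delta_vec R delta))%:R.
have := expectation_quasi_posterior_le ell_meas mE hrho0 hrho1 omega_gt0
  hkappabar EE0 Q ratio_le.
rewrite /Q => hle; apply: le_trans hle _.
rewrite lee_fin powE -expRN.
apply: (@le_trans _ _ (\sum_(delta | Q delta) expR (- (u * j / 2 * ln p%:R)) *
   p%:R^-1 ^+ norm_l0 (delta_vec R delta))).
  apply: ler_sum => delta Qd; set k := norm_l0 (delta_vec R delta).
  have -> : Num.sqrt (rho1 / (rho1 + kappabar)) = expR (- (g / 2)).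
    rewrite (_ : rho1 / _ = expR (- (g / 2)) ^+ 2); last first.
      rewrite -expRM_natl (_ : 2 * - (g / 2) = - g); last by field.
      rewrite expRN lnK ?posrE ?(lt_le_trans ltr01 g_arg)//.
      by field; rewrite !gt_eqF// addr_gt0.
    by rewrite sqrtr_sqr ger0_norm ?expR_ge0.
  have -> : p%:R^-1 = expR (- ln p%:R) :> R by rewrite expRN lnK.
  rewrite -!expRM_natl -!expRD invfM mulrA -expRN !omegaE norm_l0_supp.
  rewrite (prior_ratioE p1 hq hqu) ?norm_l0_delta_vec_le//; last first.
    by rewrite -norm_l0_supp norm_l0_delta_vec_le.
  rewrite -!expRD ler_expR -/s -/k.
  have Bp : 1 / 2 + 2 * rho1 <= u / 2 * ln p%:R.
    rewrite -ler_expR -powE expRD; apply: le_trans hpu.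
    rewrite ler_wpM2r ?expR_ge0// -(ler_pXn2r (n := 2))// ?nnegrE ?expR_ge0//.
    rewrite -expRM_natl (_ : 2 * _ = 1); last by field.
    by apply: le_trans (expR1_le3 R) _; lra.
  have := @posterior_exponent_le R u c0 (ln p%:R) rho1 (norm_l2 theta_star ^+ 2)
    A g s k%:R j hu lp0 s0 hrho1 (sqr_ge0 _) c0_ge0 (le_trans ler01 j1) Bp hc0' Qd.
  lra.
rewrite -mulr_sumr mulrC ler_wpM2r ?expR_ge0//.
apply: sum_delta_powers_le; first exact: ltnW.
move=> delta; rewrite /Q => Qd; rewrite -(ltr0n R); apply: lt_le_trans Qd.
rewrite /K ltr_wpDl ?(lt_le_trans ltr01 j1)//.
by rewrite mulr_ge0 ?addr_ge0 ?mulr_ge0 ?invr_ge0 ?addr_ge0 ?(ltW s0) ?(ltW hu).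
Qed.
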